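(* A square real-rational transfer function matrix $G(s)$ is lossless negative imaginary if and only if all of the following hold: (1) all poles of elements of $G(s)$ are purely imaginary; (2) if $s=0$ is a pole of $G(s)$, it is at most a double pole, $\lim_{s\to 0}s^{2}G(s)$ is positive semidefinite Hermitian, and $\lim_{s\to 0}s^{m}G(s)=0$ for all $m\ge 3$; (3) if $s=j\omega_0$ with $\omega_0>0$ finite is a pole of $G(s)$, it is at most a simple pole and the residue matrix $K=\lim_{s\to j\omega_0}(s-j\omega_0)jG(s)$ is positive semidefinite Hermitian; (4) if $s=j\infty$ is a pole of $G(s)$, it is at most a double pole, $\lim_{\omega\to\infty}\frac{G(j\omega)}{(j\omega)^2}$ is negative semidefinite Hermitian, and $\lim_{\omega\to\infty}\frac{G(j\omega)}{(j\omega)^m}=0$ for all $m\ge 3$; (5) $G(s)=G^{T}(-s)$ for all $s$ such that $s$ is not a pole of any element of $G(s)$.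
   Context: $A^{T}$ and $A^{*}$ denote the transpose and complex conjugate transpose of a matrix. Here $G(s)$ is not assumed proper. ''Purely imaginary'' in (1) means that the finite poles lie on the imaginary axis (real part zero); $s=0$ is included, and a pole at infinity is also allowed and is governed by (4). A square real-rational transfer function matrix $G(s)$ (a square matrix of rational functions with real coefficients) is negative imaginary if: (i) $G(s)$ has no poles in $\mathrm{Re}[s]>0$; (ii) $j[G(j\omega)-G^{*}(j\omega)]\ge 0$ for all $\omega>0$ except values of $\omega$ where $j\omega$ is a pole of $G(s)$; (iii) if $s=0$ is a pole of $G(s)$, then it is at most a double pole, $\lim_{s\to 0}s^{2}G(s)$ is positive semidefinite Hermitian, and $\lim_{s\to 0}s^{m}G(s)=0$ for all $m\ge 3$; (iv) if $s=j\omega_0$ with $\omega_0>0$ finite is a pole of $G(s)$, it is at most a simple pole and $K=\lim_{s\to j\omega_0}(s-j\omega_0)jG(s)$ is positive semidefinite Hermitian; (v) if $s=j\infty$ is a pole of $G(s)$, then it is at most a double pole, $\lim_{\omega\to\infty}G(j\omega)/(j\omega)^2$ is negative semidefinite Hermitian, and $\lim_{\omega\to\infty}G(j\omega)/(j\omega)^m=0$ for all $m\ge 3$. A square real-rational $G(s)$ is lossless negative imaginary if it is negative imaginary and $j[G(j\omega)-G^{*}(j\omega)]=0$ for all $\omega>0$ except values of $\omega$ where $j\omega$ is a pole of $G(s)$. *)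

(* Defs.v *)
From HB Require Import structures.
From mathcomp Require Import all_boot all_order all_algebra.
From mathcomp Require Import sesquilinear spectral.
From mathcomp Require Import all_classical all_reals all_analysis.
From mathcomp Require Import complex.
Set Implicit Arguments. Unset Strict Implicit. Unset Printing Implicit Defensive.
Import Order.TTheory GRing.Theory Num.Theory.
Import numFieldNormedType.Exports.
Local Open Scope ring_scope.
Local Open Scope complex_scope.
Local Open Scope classical_set_scope.
Local Open Scope sesquilinear_scope.

(* The usual topology of the complex numbers, given by the modulus. *)
HB.instance Definition _ (R : realType) := PseudoPointedMetric.copy R[i] R[i]^o.
HB.instance Definition _ (R : realType) := NormedModule.copy R[i] R[i]^o.

(* The representative of a fraction chosen by [repr] need not be in lowest
   terms, hence the division by the gcd; [rat_num f] and [rat_den f] are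
   coprime and determined by [f] up to a common nonzero constant. *)
Definition rat_num (R : fieldType) (f : {fraction {poly R}}) : {poly R} :=
  (frac (repr f)).1 %/ gcdp (frac (repr f)).1 (frac (repr f)).2.

Definition rat_den (R : fieldType) (f : {fraction {poly R}}) : {poly R} :=
  (frac (repr f)).2 %/ gcdp (frac (repr f)).1 (frac (repr f)).2.

Definition cpoly (R : realType) (p : {poly R}) : {poly R[i]} :=
  map_poly (real_complex R) p.

(* Pointwise value of [G] away from its poles; an entry with a pole at [s] gets
   the junk value 0 there. *)
Definition tfm_eval (R : realType) (n : nat)
    (G : 'M[{fraction {poly R}}]_n) (s : R[i]) : 'M[R[i]]_n :=
  \matrix_(i, j) ((cpoly (rat_num (G i j))).[s] / (cpoly (rat_den (G i j))).[s]).

Definition is_pole (R : realType) (n : nat)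
    (G : 'M[{fraction {poly R}}]_n) (s : R[i]) : Prop :=
  exists i j, root (cpoly (rat_den (G i j))) s.

Definition pole_order (R : realType) (n : nat)
    (G : 'M[{fraction {poly R}}]_n) (s : R[i]) : nat :=
  \max_i \max_j mup s (cpoly (rat_den (G i j))).

(* The truncated difference of sizes is [deg num - deg den] when this is
   positive and 0 otherwise. *)
Definition pole_order_infty (R : realType) (n : nat)
    (G : 'M[{fraction {poly R}}]_n) : nat :=
  \max_i \max_j (size (rat_num (G i j)) - size (rat_den (G i j)))%N.

Definition psd_herm (R : realType) (n : nat) (A : 'M[R[i]]_n) : Prop :=
  A \is hermsymmx /\ forall x : 'cV[R[i]]_n, 0 <= (x ^t* *m A *m x) 0 0.

Definition nsd_herm (R : realType) (n : nat) (A : 'M[R[i]]_n) : Prop :=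
  A \is hermsymmx /\ forall x : 'cV[R[i]]_n, (x ^t* *m A *m x) 0 0 <= 0.

Definition jw (R : realType) (w : R) : R[i] := 'i * w%:C.

Definition pole_zero_cond (R : realType) (n : nat)
    (G : 'M[{fraction {poly R}}]_n) : Prop :=
  is_pole G (0 : R[i]) ->
  [/\ (pole_order G 0%R <= 2)%N,
      exists2 L : 'M[R[i]]_n,
        (fun s : R[i] => s ^+ 2 *: tfm_eval G s) @ (0 : R[i])^' --> L
        & psd_herm L
    & forall m : nat, (3 <= m)%N ->
        (fun s : R[i] => s ^+ m *: tfm_eval G s) @ (0 : R[i])^'
          --> (0 : 'M[R[i]]_n)].

Definition pole_imag_cond (R : realType) (n : nat)
    (G : 'M[{fraction {poly R}}]_n) : Prop :=
  forall w0 : R, 0 < w0 -> is_pole G (jw w0) ->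
  (pole_order G (jw w0) <= 1)%N /\
  exists2 K : 'M[R[i]]_n,
    (fun s : R[i] => ((s - jw w0) * 'i) *: tfm_eval G s) @ (jw w0)^' --> K
    & psd_herm K.

Definition pole_infty_cond (R : realType) (n : nat)
    (G : 'M[{fraction {poly R}}]_n) : Prop :=
  (0 < pole_order_infty G)%N ->
  [/\ (pole_order_infty G <= 2)%N,
      exists2 L : 'M[R[i]]_n,
        (fun w : R => (jw w ^+ 2)^-1 *: tfm_eval G (jw w)) @ +oo --> L
        & nsd_herm L
    & forall m : nat, (3 <= m)%N ->
        (fun w : R => (jw w ^+ m)^-1 *: tfm_eval G (jw w)) @ +oo
          --> (0 : 'M[R[i]]_n)].

Definition imag_form (R : realType) (n : nat)
    (G : 'M[{fraction {poly R}}]_n) (w : R) : 'M[R[i]]_n :=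
  'i *: (tfm_eval G (jw w) - (tfm_eval G (jw w)) ^t*).

Definition negative_imaginary (R : realType) (n : nat)
    (G : 'M[{fraction {poly R}}]_n) : Prop :=
  [/\ forall s : R[i], is_pole G s -> ~ (0 < complex.Re s),
      forall w : R, 0 < w -> ~ is_pole G (jw w) -> psd_herm (imag_form G w),
      pole_zero_cond G,
      pole_imag_cond G
    & pole_infty_cond G].

Definition lossless_negative_imaginary (R : realType) (n : nat)
    (G : 'M[{fraction {poly R}}]_n) : Prop :=
  negative_imaginary G /\
  forall w : R, 0 < w -> ~ is_pole G (jw w) -> imag_form G w = 0.

(* Main.v *)
Require Import Defs.
From HB Require Import structures.
From mathcomp Require Import all_boot all_order all_algebra.
From mathcomp Require Import sesquilinear.
From mathcomp Require Import all_classical all_reals all_analysis.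
From mathcomp Require Import complex.
Set Implicit Arguments. Unset Strict Implicit. Unset Printing Implicit Defensive.
Import Order.TTheory GRing.Theory Num.Theory.
Import numFieldNormedType.Exports.
Local Open Scope ring_scope.
Local Open Scope complex_scope.
Local Open Scope classical_set_scope.

(* The coefficients of G are real, so G(jw)^* = G(-jw)^T, and losslessness
   says that G(s) = G(-s)^T on the positive imaginary axis off the poles.
   Two rational functions agreeing at infinitely many points agree everywhere;
   as the entries are in lowest terms, this identity also makes the set of poles
   symmetric under s |-> -s, so that the absence of poles in the right half-plane
   forces all of them onto the imaginary axis. *)

Lemma rat_den_neq0 (F : fieldType) (f : {fraction {poly F}}) : rat_den f != 0.
Proof. by rewrite dvdp_div_eq0 ?dvdp_gcdr // denom_ratioP. Qed.

Lemma coprimep_rat (F : fieldType) (f : {fraction {poly F}}) :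
  coprimep (rat_num f) (rat_den f).
Proof. by rewrite coprimep_div_gcd // denom_ratioP orbT. Qed.

Lemma conj_cpoly (R : realType) (p : {poly R}) (s : R[i]) :
  Num.conj (cpoly p).[s] = (cpoly p).[Num.conj s].
Proof.
rewrite /cpoly -horner_map -map_poly_comp.
by congr (_.[_]); apply: eq_map_poly => x /=; exact: conjc_real.
Qed.

Lemma conj_jw (R : realType) (w : R) : Num.conj (jw w) = - jw w.
Proof.
rewrite /jw rmorphM /= conjCi mulNr; congr (- (_ * _)).
exact: conjc_real.
Qed.

Lemma jw_inj (R : realType) : injective (@jw R).
Proof.
by move=> x y /(mulfI (@neq0Ci _)) /(fmorph_inj (real_complex R)).
Qed.

(** No pole needs excluding: conjugation commutes with inversion even at 0, so the junk values agree
    as well. *)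
Lemma conj_tfm_eval_jw (R : realType) (n : nat)
    (G : 'M[{fraction {poly R}}]_n) (w : R) :
  (tfm_eval G (jw w) ^t*)%sesqui = (tfm_eval G (- jw w))^T.
Proof.
by apply/matrixP => i j; rewrite !mxE rmorphM /= fmorphV /= !conj_cpoly conj_jw.
Qed.

Lemma imag_form_eq0 (R : realType) (n : nat)
    (G : 'M[{fraction {poly R}}]_n) (w : R) :
  imag_form G w = 0 <-> tfm_eval G (jw w) = (tfm_eval G (- jw w))^T.
Proof.
rewrite /imag_form conj_tfm_eval_jw; split => [/eqP|->].
  by rewrite scaler_eq0 (negPf (neq0Ci _)) subr_eq0 => /eqP.
by rewrite subrr scaler0.
Qed.

Lemma psd_herm0 (R : realType) (n : nat) : psd_herm (0 : 'M[R[i]]_n).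
Proof.
split; last by move=> x; rewrite mulmx0 mul0mx mxE.
by apply/is_hermitianmxP; rewrite trmx0 map_mx0 scaler0.
Qed.

Lemma poly_jw_eq0 (R : realType) (p : {poly R[i]}) :
  (forall w : R, 0 < w -> p.[jw w] = 0) -> p = 0.
Proof.
move=> p0; apply/eqP/negPn/negP => pN0.
(* The points j, 2j, 3j, ... give [size p] distinct roots, one more than the degree allows; the
   shift to [k.+1] keeps w positive. *)
pose rs := [seq jw (k.+1%:R : R) | k <- iota 0 (size p)].
suff: (size rs < size p)%N by rewrite size_map size_iota ltnn.
apply: max_poly_roots => //.
  by apply/allP => _ /mapP[k _ ->]; apply/rootP/p0; rewrite ltr0Sn.
rewrite map_inj_uniq ?iota_uniq // => k l /jw_inj /eqP.
by rewrite eqr_nat eqSS => /eqP.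
Qed.

(** Clearing denominators turns the symmetry into a polynomial identity, valid also at the poles,
    where [tfm_eval] carries no information. *)
Lemma cross_mul_tfm (R : realType) (n : nat) (G : 'M[{fraction {poly R}}]_n) :
  (forall w : R, 0 < w -> ~ is_pole G (jw w) ->
    tfm_eval G (jw w) = (tfm_eval G (- jw w))^T) ->
  forall (i j : 'I_n) (s : R[i]),
  (cpoly (rat_num (G i j))).[s] * (cpoly (rat_den (G j i))).[- s] =
  (cpoly (rat_num (G j i))).[- s] * (cpoly (rat_den (G i j))).[s].
Proof.
move=> lossless i j s.
pose N k l := cpoly (rat_num (G k l)); pose D k l := cpoly (rat_den (G k l)).
have D0 k l : D k l != 0 by rewrite map_poly_eq0 rat_den_neq0.
(* [E] vanishes at every pole, so [F * E] below vanishes at all [jw w] with w > 0, with no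
   exceptional points left. *)
pose E := \prod_k \prod_l D k l.
have E0 : E != 0 by apply/prodf_neq0 => k _; apply/prodf_neq0 => l _.
have EN t : is_pole G t -> E.[t] = 0.
  case=> k [l /rootP Dt0]; rewrite /E horner_prod (bigD1 k) //= horner_prod.
  by rewrite (bigD1 l) //= Dt0 !mul0r.
have DN0 t k l : ~ is_pole G t -> (D k l).[t] != 0.
  by move=> tP; apply/negP => r; apply: tP; exists k, l; apply: r.
pose F := N i j * (D j i \Po - 'X) - (N j i \Po - 'X) * D i j.
have FE t : F.[t] = (N i j).[t] * (D j i).[- t] - (N j i).[- t] * (D i j).[t].
  by rewrite /F !(hornerE, horner_comp).
suff F0 : F = 0 by apply/eqP; rewrite -subr_eq0 -FE F0 horner0.
suff /eqP : F * E = 0 by rewrite mulf_eq0 (negPf E0) orbF => /eqP.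
apply: poly_jw_eq0 => w w0; rewrite hornerM.
have [/EN ->|wP] := pselect (is_pole G (jw w)); first by rewrite mulr0.
have D1 : (D i j).[jw w] != 0 by exact: DN0.
(* By real coefficients, this value is the conjugate of the one at [jw w], which is not a pole. *)
have D2 : (D j i).[- jw w] != 0.
  by rewrite -conj_jw -conj_cpoly fmorph_eq0; exact: DN0.
have /matrixP/(_ i j) := lossless w w0 wP; rewrite !mxE => /eqP.
by rewrite eqr_div // => /eqP eND; rewrite FE eND subrr mul0r.
Qed.

(** At a pole of entry (i, j) the numerator is nonzero by coprimality, so the cross-multiplied
    identity forces the denominator of entry (j, i) to vanish at [- s]. *)
Lemma is_poleN (R : realType) (n : nat) (G : 'M[{fraction {poly R}}]_n) :
  (forall w : R, 0 < w -> ~ is_pole G (jw w) ->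
    tfm_eval G (jw w) = (tfm_eval G (- jw w))^T) ->
  forall s, is_pole G s -> is_pole G (- s).
Proof.
move=> lossless s [i [j Ds0]]; exists j, i.
have Ns : (cpoly (rat_num (G i j))).[s] != 0.
  by apply: coprimep_root Ds0; rewrite coprimep_map coprimep_sym coprimep_rat.
have := cross_mul_tfm lossless i j s.
rewrite (rootP Ds0) mulr0 => /eqP; rewrite mulf_eq0 (negPf Ns) /=.
exact.
Qed.

Theorem lemma3 (R : realType) (n : nat) (G : 'M[{fraction {poly R}}]_n) :
  lossless_negative_imaginary G <->
  [/\ forall s : R[i], is_pole G s -> complex.Re s = 0,
      pole_zero_cond G,
      pole_imag_cond G,
      pole_infty_cond G
    & forall s : R[i], ~ is_pole G s ->
        tfm_eval G s = (tfm_eval G (- s))^T].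
Proof.
split=> [[[noRHP _ pz pim pinf] lossless0]|[imP pz pim pinf sym]].
  have lossless w (w0 : 0 < w) (wP : ~ is_pole G (jw w)) :
      tfm_eval G (jw w) = (tfm_eval G (- jw w))^T.
    by apply/imag_form_eq0; exact: lossless0.
  have poleN := is_poleN lossless.
  split=> // s sP.
    apply/eqP; rewrite eq_le; apply/andP; split; rewrite leNgt; apply/negP.
      exact: noRHP sP.
    by move=> s0; apply: (noRHP _ (poleN s sP)); rewrite raddfN oppr_gt0.
  have DN0 i j : (cpoly (rat_den (G i j))).[s] != 0.
    by apply/negP => r; apply: sP; exists i, j; apply: r.
  (* By the symmetry of the pole set, [- s] is not a pole either, so the identity can be divided
     back. *)
  have DNN0 i j : (cpoly (rat_den (G i j))).[- s] != 0.
    apply/negP => r; apply: sP; rewrite -[s]opprK; apply: poleN.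
    by exists i, j; apply: r.
  apply/matrixP => i j; rewrite !mxE; apply/eqP; rewrite eqr_div //.
  by apply/eqP; exact: cross_mul_tfm.
have lossless w (w0 : 0 < w) (wP : ~ is_pole G (jw w)) : imag_form G w = 0.
  by apply/imag_form_eq0; exact: sym.
(* What remains is the right half-plane condition and positivity of a form that is identically
   zero. *)
split=> //; split=> // [s sP|w w0 wP].
  by rewrite imP // ltxx.
by rewrite lossless //; exact: psd_herm0.
Qed.
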